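(* Let $0\leq m_r\leq d_r$, $0\leq m_f\leq d_f$ satisfy $d_r\geq d_f-m_f$ and $d_f\geq d_r-m_r$. The following are equivalent: (i) $Sol_{BDC}^{m_r,d_r,m_f,d_f}$ is symmetrical, i.e. for every $u\in S$, $Sol_{BDC}^{m_r,d_r,m_f,d_f}(\overline{u})=\{\overline{x}\mid x\in Sol_{BDC}^{m_r,d_r,m_f,d_f}(u)\}$, where $\overline{u}(t)=\overline{u(t)}$; (ii) $d_r=d_f$ and $m_r=m_f$.
   Context: $\mathbf{B}=\{0,1\}$ with Boolean operations, complement $\overline{\ \cdot\ }$, ordered by $0<1$. $S$ is the set of signals: functions $x:\mathbb{R}\to\mathbf{B}$ for which there is a strictly increasing unbounded sequence $t_0<t_1<t_2<\dots$ of reals such that $x$ is constant on $(-\infty,t_0)$ and on each $[t_k,t_{k+1})$. For a bounded interval $I$ and $u\in S$, $\bigcap_{\xi\in I}u(\xi)$ equals $1$ iff $u(\xi)=1$ for all $\xi\in I$, and $\bigcup_{\xi\in I}u(\xi)$ equals $1$ iff $u(\xi)=1$ for some $\xi\in I$. For $0\leq m_r\leq d_r$, $0\leq m_f\leq d_f$ and $u\in S$, $Sol_{BDC}^{m_r,d_r,m_f,d_f}(u)$ is the set of $x\in S$ such that for all $t\in\mathbb{R}$: $\bigcap_{\xi\in[t-d_r,t-d_r+m_r]}u(\xi)\leq x(t)\leq\bigcup_{\xi\in[t-d_f,t-d_f+m_f]}u(\xi)$. *)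

(* Defs.v *)
From HB Require Import structures.
From mathcomp Require Import all_boot all_order all_algebra.
From mathcomp Require Import all_classical all_reals all_analysis.

Set Implicit Arguments.
Unset Strict Implicit.
Unset Printing Implicit Defensive.

Import Order.TTheory GRing.Theory Num.Theory.

Local Open Scope classical_set_scope.
Local Open Scope ring_scope.

(* [increasing_seq] is strict: it is [{mono t : n m / (n <= m)%N >-> n <= m}]. *)
Definition signal (R : realType) : set (R -> bool) :=
  [set x | exists t : nat -> R,
    [/\ increasing_seq t,
        ~ has_ubound (range t),
        {in `]-oo, t 0%N[ &, forall s s', x s = x s'} &
        forall k, {in `[t k, t k.+1[ &, forall s s', x s = x s'}]].

Definition inter_on (R : realType) (I : interval R) (u : R -> bool) : bool :=
  `[< forall xi, xi \in I -> u xi = true >].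

Definition union_on (R : realType) (I : interval R) (u : R -> bool) : bool :=
  `[< exists2 xi, xi \in I & u xi = true >].

(* The inequalities are those of the order [false < true] on [bool]. *)
Definition Sol_BDC (R : realType) (mr dr mf df : R) (u : R -> bool) :
    set (R -> bool) :=
  [set x | signal x /\ forall t,
    (inter_on `[t - dr, t - dr + mr] u <= x t)%O /\
    (x t <= union_on `[t - df, t - df + mf] u)%O].

Definition compl_sig (R : realType) (x : R -> bool) : R -> bool :=
  fun t => ~~ x t.

Definition symmetrical (R : realType) (F : (R -> bool) -> set (R -> bool)) :
    Prop :=
  forall u, signal u -> F (compl_sig u) = [set compl_sig x | x in F u].

(* Main.v *)
(** Complementation exchanges intersections and unions, so [symmetrical] says
    that exchanging the parameters [(mr, dr)] and [(mf, df)] does not change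
    the solution set of any signal.  The inequalities between the parameters
    make the two windows meet, so that the lower bound
    [fun t => inter_on `[t - dr, t - dr + mr] u] stays below the upper one.
    For the indicator [u] of a long interval [[0, b[] this lower bound is the
    indicator of [[dr, b + dr - mr[], hence itself a solution; comparing it with
    the indicator of [[df, b + df - mf[] obtained from the exchanged parameters
    forces [dr = df] and [mr = mf]. *)
Require Import Defs.
From HB Require Import structures.
From mathcomp Require Import all_boot all_order all_algebra.
From mathcomp Require Import all_classical all_reals all_analysis.
From mathcomp Require Import lra.

Import Order.TTheory GRing.Theory Num.Theory.

Local Open Scope classical_set_scope.
Local Open Scope ring_scope.

Lemma lebE (b c : bool) : (b <= c)%O = (b ==> c).
Proof. by case: b; case: c. Qed.

Lemma compl_sigK (R : realType) : involutive (@compl_sig R).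
Proof. by move=> x; apply/funext => t; rewrite /compl_sig negbK. Qed.

Lemma signal_compl (R : realType) (x : R -> bool) :
  signal x -> signal (compl_sig x).
Proof.
move=> [t [tinc tub x0 xk]]; exists t; split=> // [s s' hs hs'|k s s' hs hs'].
  by rewrite /compl_sig (x0 s s').
by rewrite /compl_sig (xk k s s').
Qed.

Lemma union_on_compl (R : realType) (I : interval R) (u : R -> bool) :
  union_on I (compl_sig u) = ~~ inter_on I u.
Proof.
rewrite /union_on /inter_on -asbool_neg; apply: asbool_equiv_eq; split.
  by move=> [xi xiI uxi] /(_ xi xiI) uT; move: uxi; rewrite /compl_sig uT.
move=> /existsNP[xi /not_implyP[xiI /negP uxi]].
by exists xi.
Qed.

Lemma inter_on_compl (R : realType) (I : interval R) (u : R -> bool) :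
  inter_on I (compl_sig u) = ~~ union_on I u.
Proof. by rewrite -{2}(compl_sigK _ u) union_on_compl negbK. Qed.

(** By De Morgan each bound becomes the negation of the other, and contraposition swaps the two
    inequalities. *)
Lemma Sol_BDC_compl (R : realType) (mr dr mf df : R) (u x : R -> bool) :
  Sol_BDC mf df mr dr u x ->
  Sol_BDC mr dr mf df (compl_sig u) (compl_sig x).
Proof.
move=> [sx bx]; split; first exact: signal_compl.
move=> t; have [lo up] := bx t; move: lo up.
by rewrite inter_on_compl union_on_compl !lebE /compl_sig !implybNN.
Qed.

Lemma symmetricalP (R : realType) (mr dr mf df : R) :
  symmetrical (Sol_BDC mr dr mf df) <->
  forall u, signal u -> Sol_BDC mr dr mf df u = Sol_BDC mf df mr dr u.
Proof.
split=> [sym u su|sym u su]; apply/seteqP; split=> x Sx.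
- have : Sol_BDC mr dr mf df (compl_sig u) (compl_sig x).
    by rewrite sym//; exists x.
  by move=> /Sol_BDC_compl; rewrite !compl_sigK.
- have := Sol_BDC_compl _ _ _ _ _ _ _ Sx; rewrite sym// => -[y Sy].
  by move=> /(can_inj (compl_sigK R)) <-.
- exists (compl_sig x); last exact: compl_sigK.
  by rewrite sym// -(compl_sigK R u); exact: Sol_BDC_compl.
- case: Sx => y; rewrite sym// => Sy <-; exact: Sol_BDC_compl.
Qed.

(** Half-open, to match the pieces on which signals are constant. *)
Definition pulse (R : realType) (p q : R) : R -> bool := fun t => p <= t < q.

Lemma signal_pulse (R : realType) (p q : R) : p < q -> signal (pulse R p q).
Proof.
(* The value switches at [p] and [q] only; the times [q + n] make the sequence unbounded. *)
move=> pq; exists (fun k => if k is n.+1 then q + n%:R else p); split.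
- apply/increasing_seqP => -[|n]; rewrite ?addr0//.
  by rewrite ltrD2l ltr_nat.
- move=> [M ubM]; have M0 := ubM (q + (Num.truncn `|M - q|).+1%:R).
  have := truncnS_gt `|M - q|; have := ler_norm (M - q).
  have := M0 (ex_intro2 _ _ (Num.truncn `|M - q|).+2 I erefl).
  by lra.
- move=> s s'; rewrite !in_itv /= /pulse => sp s'p.
  by rewrite !(leNgt p) sp s'p.
- move=> [|n] s s'; rewrite !in_itv /= /pulse ?addr0; first by move=> -> ->.
  move=> /andP[qs _] /andP[qs' _]; have n0 : 0 <= n%:R :> R by [].
  have {}qs : q <= s by lra.
  have {}qs' : q <= s' by lra.
  by rewrite !(ltNge _ q) qs qs' !andbF.
Qed.

(** By convexity, a window lies in [[p, q[] as soon as its two endpoints do. *)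
Lemma inter_on_pulse (R : realType) (p q s m : R) : 0 <= m ->
  inter_on `[s, s + m] (pulse R p q) = pulse R p (q - m) s.
Proof.
move=> m0; apply/asboolP/idP; rewrite /pulse.
  move=> H.
  have /H/andP[ps _] : s \in `[s, s + m] by rewrite in_itv /= lexx lerDl.
  have /H/andP[_ smq] : s + m \in `[s, s + m].
    by rewrite in_itv /= lexx lerDl m0.
  by apply/andP; split; lra.
move=> /andP[ps sq] xi; rewrite in_itv /= => /andP[sx xs].
by apply/andP; split; lra.
Qed.

Lemma pulse_sub (R : realType) (p q p' q' : R) : p < q ->
  (forall t, pulse R p q t -> pulse R p' q' t) -> p' <= p /\ q <= q'.
Proof.
move=> pq sub; split.
  by have /sub/andP[] : pulse R p q p by rewrite /pulse lexx.
rewrite leNgt; apply/negP => q'q.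
(* If [q' < q], this point is in the first pulse but not before [q']. *)
have /sub/andP[_] : pulse R p q (Num.max p q').
  by rewrite /pulse le_max lexx gt_max pq q'q.
by rewrite ltNge le_max lexx orbT.
Qed.

Lemma inter_on_le_union_on (R : realType) (a b c d : R) (u : R -> bool) :
  a <= b -> c <= d -> a <= d -> c <= b ->
  (inter_on `[a, b] u <= union_on `[c, d] u)%O.
Proof.
move=> ab cd ad cb; rewrite lebE; apply/implyP => /asboolP uI; apply/asboolP.
(* The larger left endpoint is common to both windows. *)
exists (Num.max a c); last apply: uI.
  by rewrite in_itv /= le_max lexx orbT ge_max ad cd.
by rewrite in_itv /= le_max lexx ge_max ab cb.
Qed.

Lemma pulse_Sol_BDC (R : realType) (mr dr mf df b : R) :
  0 <= mr -> 0 <= mf -> df - mf <= dr -> dr - mr <= df -> mr < b ->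
  Sol_BDC mr dr mf df (pulse R 0 b) (pulse R dr (b + dr - mr)).
Proof.
move=> mr0 mf0 hr hf mrb; split; first by apply: signal_pulse; lra.
move=> t; have -> : pulse R dr (b + dr - mr) t =
    inter_on `[t - dr, t - dr + mr] (pulse R 0 b).
  by rewrite inter_on_pulse// /pulse subr_ge0 ltrBlDr addrAC.
by split=> //; apply: inter_on_le_union_on; lra.
Qed.

Lemma Sol_BDC_pulse_sub (R : realType) (mr dr mf df b p q : R) :
  0 <= mr -> mr < b ->
  Sol_BDC mr dr mf df (pulse R 0 b) (pulse R p q) ->
  p <= dr /\ b + dr - mr <= q.
Proof.
move=> mr0 mrb [_ Sx]; apply: pulse_sub; first by lra.
move=> t /andP[drt tb]; have [+ _] := Sx t.
rewrite inter_on_pulse// lebE => /implyP; apply.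
by apply/andP; split; lra.
Qed.

Theorem theorem1p4 (R : realType) (mr dr mf df : R)
    (hmr : 0 <= mr) (hmrdr : mr <= dr) (hmf : 0 <= mf) (hmfdf : mf <= df)
    (hr : df - mf <= dr) (hf : dr - mr <= df) :
  symmetrical (Sol_BDC mr dr mf df) <-> (dr = df /\ mr = mf).
Proof.
split=> [/symmetricalP sym|[-> ->]]; last exact/symmetricalP.
(* Exceeding both [mr] and [mf] keeps both lower-bound pulses nonempty. *)
pose b := mr + mf + 1.
have mrb : mr < b by rewrite /b; lra.
have mfb : mf < b by rewrite /b; lra.
have b0 : 0 < b by lra.
have symb := sym _ (signal_pulse R 0 b b0).
(* Each least solution also solves the exchanged problem, so it contains the other one; the endpoint
   inequalities hold both ways. *)
have := pulse_Sol_BDC R mr dr mf df b hmr hmf hr hf mrb.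
rewrite symb => /(Sol_BDC_pulse_sub _ _ _ _ _ _ _ _ hmf mfb) [? ?].
have := pulse_Sol_BDC R mf df mr dr b hmf hmr hf hr mfb.
rewrite -symb => /(Sol_BDC_pulse_sub _ _ _ _ _ _ _ _ hmr mrb) [? ?].
by split; lra.
Qed.
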